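(* Let $G$ be an abelian group. If $G=G_1\oplus G_2$ for some subgroups $G_1,G_2$ of $G$, then: (a) $s(G)=0$ implies $s(G_1)=s(G_2)=0$; (b) $ns(G)=0$ implies $ns(G_1)=ns(G_2)=0$; (c) $s_0(G)=0$ implies $s_0(G_1)=s_0(G_2)=0$.
   Context: $\mathbb N=\{0,1,2,\dots\}$ and $\mathbb N_+=\mathbb N\setminus\{0\}$. Let $\phi$ be an endomorphism of an abelian group $G$. A string of $\phi$ is a sequence $S=\{x_n\}_{n\in\mathbb N}$ of pairwise distinct elements of $G$ such that $\phi(x_n)=x_{n-1}$ for every $n\in\mathbb N_+$. A string is singular if $\phi^j(x_0)=\phi^k(x_0)$ for some $j\neq k$ in $\mathbb N$, and non-singular otherwise; it is a null string if $x_0\neq 0$ and $\phi^k(x_0)=0$ for some $k\in\mathbb N_+$. Define $s(\phi)$ (respectively $ns(\phi)$, $s_0(\phi)$) as the supremum of the cardinalities $|\mathcal F|$, where $\mathcal F$ ranges over the families of pairwise disjoint strings (respectively non-singular strings, null strings) of $\phi$; if this supremum is infinite it is set equal to the symbol $\infty$. For an abelian group $G$, $s(G)=\sup\{s(\phi):\phi\in\mathrm{End}(G)\}$, $ns(G)=\sup\{ns(\phi):\phi\in\mathrm{End}(G)\}$, $s_0(G)=\sup\{s_0(\phi):\phi\in\mathrm{End}(G)\}$. *)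

(* Defs.v *)
From HB Require Import structures.
From mathcomp Require Import all_boot all_order all_algebra.
From mathcomp Require Import boolp classical_sets functions cardinality.
From mathcomp Require Import reals constructive_ereal ereal counting_measure.
Set Implicit Arguments.
Unset Strict Implicit.
Unset Printing Implicit Defensive.
Import Order.TTheory GRing.Theory Num.Theory.
Local Open Scope classical_set_scope.
Local Open Scope ring_scope.

Section Strings.
Variables (G : zmodType) (phi : {additive G -> G}).

Definition is_string (x : nat -> G) : Prop :=
  injective x /\ forall n : nat, phi (x n.+1) = x n.

Definition singular (x : nat -> G) : Prop :=
  exists j k : nat, j <> k /\ iter j phi (x 0%N) = iter k phi (x 0%N).

Definition strings : set (nat -> G) := [set x | is_string x].

Definition nonsingular_strings : set (nat -> G) :=
  [set x | is_string x /\ ~ singular x].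

Definition null_strings : set (nat -> G) :=
  [set x | [/\ is_string x, x 0%N <> 0 &
               exists k : nat, (0 < k)%N /\ iter k phi (x 0%N) = 0]].

End Strings.

(* Two strings are disjoint when their ranges are. As ranges are nonempty, an
   indexed family of pairwise disjoint strings is injective, so that such a
   family can be taken to be a set F of strings. *)
Definition disjoint_families (G : zmodType) (A : set (nat -> G)) :
    set (set (nat -> G)) :=
  [set F | F `<=` A /\ trivIset F (fun x : nat -> G => range x)].

(* [counting F] is the number of elements of F, and +oo when F is infinite;
   hence infinite suprema are all identified with the symbol +oo. The real type
   R only serves to provide the extended line \bar R holding these values. *)
Definition max_disjoint (R : realType) (G : zmodType) (A : set (nat -> G)) :
    \bar R :=
  ereal_sup [set counting F | F in disjoint_families A].

Section StringNumbers.
Variables (R : realType) (G : zmodType).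

Definition s_end (phi : {additive G -> G}) : \bar R :=
  max_disjoint R (strings phi).
Definition ns_end (phi : {additive G -> G}) : \bar R :=
  max_disjoint R (nonsingular_strings phi).
Definition s0_end (phi : {additive G -> G}) : \bar R :=
  max_disjoint R (null_strings phi).

Definition s_grp : \bar R := ereal_sup (range s_end).
Definition ns_grp : \bar R := ereal_sup (range ns_end).
Definition s0_grp : \bar R := ereal_sup (range s0_end).

End StringNumbers.

(* A subgroup H of G, viewed as an abelian group in its own right. *)
Definition subgrp (G : zmodType) (H : zmodClosed G) : Type :=
  {x : G | x \in H}.
HB.instance Definition _ (G : zmodType) (H : zmodClosed G) :=
  Choice.on (subgrp H).
HB.instance Definition _ (G : zmodType) (H : zmodClosed G) :=
  SubChoice.on (subgrp H).
HB.instance Definition _ (G : zmodType) (H : zmodClosed G) :=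
  [SubChoice_isSubZmodule of subgrp H by <:].

Definition internal_direct_sum (G : zmodType) (G1 G2 : zmodClosed G) : Prop :=
  (forall x : G, exists y z : G, [/\ y \in G1, z \in G2 & x = y + z]) /\
  (forall x : G, x \in G1 -> x \in G2 -> x = 0).

(* Main.v *)
Require Import Defs.
From HB Require Import structures.
From mathcomp Require Import all_boot all_order all_algebra.
From mathcomp Require Import finmap.
From mathcomp Require Import boolp classical_sets cardinality.
From mathcomp Require Import reals constructive_ereal ereal counting_measure.
Set Implicit Arguments.
Unset Strict Implicit.
Unset Printing Implicit Defensive.
Import Order.TTheory GRing.Theory.
Local Open Scope ereal_scope.

(** Each of the three string numbers is a supremum of cardinalities of families,
    so it vanishes exactly when no endomorphism has a string of the given kind
    at all: the empty family contributes 0, and a single string already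
    contributes 1 ([sup_max_disjoint_eq0]). It therefore suffices to carry one
    string from a direct summand H to G. With i : H -> G the inclusion and
    p : G -> H the projection along the other summand, an endomorphism phi of H
    extends to psi = i o phi o p, and psi o i = i o phi because p o i = id. As i
    is injective and additive, x |-> i o x then preserves strings,
    non-singularity and nullity. This is an argument about retracts, and a
    summand is one: its projection is built in [summand_projection]. *)

Lemma counting_set0 (R : realType) (T : choiceType) :
  counting (@set0 T) = 0 :> \bar R.
Proof. by rewrite /counting asboolT ?fset_set0. Qed.

Lemma counting_set1 (R : realType) (T : choiceType) (x : T) :
  counting [set x]%classic = 1 :> \bar R.
Proof.
by rewrite /counting asboolT ?fset_set1 ?cardfs1; last exact: finite_set1.
Qed.

Lemma max_disjoint_ge0 (R : realType) (G : zmodType) (A : set (nat -> G)) :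
  0 <= max_disjoint R A.
Proof.
apply: ereal_sup_ubound; exists set0; last exact: counting_set0.
by split=> [x []|i j []].
Qed.

Lemma max_disjoint0 (R : realType) (G : zmodType) :
  max_disjoint R (@set0 (nat -> G)) = 0.
Proof.
apply/eqP; rewrite eq_le max_disjoint_ge0 andbT.
apply: ge_ereal_sup => _ [F [FA _] <-].
by move: FA; rewrite subset0 => ->; rewrite counting_set0.
Qed.

Lemma max_disjoint_ge1 (R : realType) (G : zmodType) (A : set (nat -> G))
    (x : nat -> G) : A x -> 1 <= max_disjoint R A.
Proof.
move=> Ax; apply: ereal_sup_ubound; exists [set x]%classic.
  by split=> [_ -> //|i j -> ->].
exact: counting_set1.
Qed.

(** This reduces each string number to a question about single strings, with no
    families left. *)
Lemma sup_max_disjoint_eq0 (R : realType) (G : zmodType)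
    (A : {additive G -> G} -> set (nat -> G)) :
  ereal_sup (range (fun phi => max_disjoint R (A phi))) = 0 <->
  forall phi x, ~ A phi x.
Proof.
split=> [sup0 phi x /(@max_disjoint_ge1 R) ge1|A0].
  suff : max_disjoint R (A phi) <= 0.
    by move=> /(le_trans ge1); rewrite leNgt lte01.
  by rewrite -sup0; apply: ereal_sup_ubound; exists phi.
have m0 phi : max_disjoint R (A phi) = 0.
  rewrite (_ : A phi = set0) ?max_disjoint0 //.
  by rewrite -subset0 => x /A0.
apply/eqP; rewrite eq_le; apply/andP; split.
  by apply: ge_ereal_sup => _ [phi _ <-]; rewrite m0.
(* The outer supremum is not -oo because G has the zero endomorphism. *)
by apply: ereal_sup_ubound; exists (\0%R : {additive G -> G}).
Qed.

Section Retract.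
Variables (G H : zmodType) (i : {additive H -> G}) (p : {additive G -> H}).
Hypothesis ip : cancel i p.

Definition extend_end (phi : {additive H -> H}) : {additive G -> G} :=
  i \o (phi \o p).

(** [i] intertwines [phi] with its extension: singularity and nullity only
    involve iterates at the image of a point of [H]. *)
Lemma iter_extend_end phi n h :
  iter n (extend_end phi) (i h) = i (iter n phi h).
Proof. by elim: n => //= n ->; rewrite /= ip. Qed.

Lemma is_string_extend_end phi x :
  is_string phi x -> is_string (extend_end phi) (i \o x).
Proof.
move=> [xI xS]; split=> [|n]; first exact: inj_comp (can_inj ip) xI.
by rewrite /= ip xS.
Qed.

Lemma nonsingular_extend_end phi x :
  nonsingular_strings phi x -> nonsingular_strings (extend_end phi) (i \o x).
Proof.
move=> [xS xN]; split; first exact: is_string_extend_end.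
move=> [j [k [jk]]]; rewrite !iter_extend_end => /(can_inj ip) e.
by apply: xN; exists j, k.
Qed.

Lemma null_extend_end phi x :
  null_strings phi x -> null_strings (extend_end phi) (i \o x).
Proof.
move=> [xS x0 [k [k0 xk]]]; split; first exact: is_string_extend_end.
- by rewrite /= -(raddf0 i) => /(can_inj ip).
- by exists k; rewrite iter_extend_end xk raddf0.
Qed.

Lemma sup_max_disjoint_retract (R : realType)
    (A : forall K : zmodType, {additive K -> K} -> set (nat -> K)) :
    (forall phi x, A H phi x -> A G (extend_end phi) (i \o x)) ->
  ereal_sup (range (fun phi => max_disjoint R (A G phi))) = 0 ->
  ereal_sup (range (fun phi => max_disjoint R (A H phi))) = 0.
Proof.
move=> AiA /sup_max_disjoint_eq0 AG0; apply/sup_max_disjoint_eq0.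
by move=> phi x /AiA; apply: AG0.
Qed.

Lemma string_numbers_retract (R : realType) :
  [/\ s_grp R G = 0 -> s_grp R H = 0,
      ns_grp R G = 0 -> ns_grp R H = 0 &
      s0_grp R G = 0 -> s0_grp R H = 0].
Proof.
split.
- exact: sup_max_disjoint_retract is_string_extend_end.
- exact: sup_max_disjoint_retract nonsingular_extend_end.
- exact: sup_max_disjoint_retract null_extend_end.
Qed.

End Retract.

Local Open Scope ring_scope.

Lemma internal_direct_sumC (G : zmodType) (G1 G2 : zmodClosed G) :
  internal_direct_sum G1 G2 -> internal_direct_sum G2 G1.
Proof.
move=> [dec tri]; split=> [x|x x2 x1]; last exact: tri.
by have [y [z [yG zG ->]]] := dec x; exists z, y; split; rewrite // addrC.
Qed.

(** The component of x in G1 is the only element of G1 congruent to x modulo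
    G2; this makes a chosen component additive in x. *)
Lemma summand_projection (G : zmodType) (G1 G2 : zmodClosed G) :
    internal_direct_sum G1 G2 ->
  exists p : {additive G -> subgrp G1},
    cancel (val : {additive subgrp G1 -> G}) p.
Proof.
move=> [dec tri].
have comp x : exists h : subgrp G1, x - val h \in G2.
  have [y [z [yG zG ->]]] := dec x.
  by exists (Sub y yG); rewrite SubK addrC addKr.
have [p pP] := choice comp.
have pE x (h : subgrp G1) : x - val h \in G2 -> p x = h.
  move=> xh; apply/val_inj/subr0_eq/tri; first exact: rpredB (valP _) (valP _).
  by rewrite -(subrKA x) addrC -[val (p x) - x]opprB rpredB.
have pB : zmod_morphism p.
  move=> x y; apply: pE.
  by rewrite [val _]raddfB opprD addrACA -opprD rpredB.
pose pA := GRing.isZmodMorphism.Build _ _ p pB.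
pose q : {additive G -> subgrp G1} := HB.pack p pA.
by exists q => h; apply: pE; rewrite subrr rpred0.
Qed.

Lemma string_numbers_summand (R : realType) (G : zmodType)
    (G1 G2 : zmodClosed G) : internal_direct_sum G1 G2 ->
  [/\ s_grp R G = 0%E -> s_grp R (subgrp G1) = 0%E,
      ns_grp R G = 0%E -> ns_grp R (subgrp G1) = 0%E &
      s0_grp R G = 0%E -> s0_grp R (subgrp G1) = 0%E].
Proof.
by move=> /summand_projection[p vp]; apply: string_numbers_retract vp R.
Qed.

Local Close Scope ring_scope.
Unset Implicit Arguments.

Theorem lemma2p6 (R : realType) (G : zmodType) (G1 G2 : zmodClosed G)
    (hG : internal_direct_sum G1 G2) :
  (s_grp R G = 0 -> s_grp R (subgrp G1) = 0 /\ s_grp R (subgrp G2) = 0) /\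
  (ns_grp R G = 0 -> ns_grp R (subgrp G1) = 0 /\ ns_grp R (subgrp G2) = 0) /\
  (s0_grp R G = 0 -> s0_grp R (subgrp G1) = 0 /\ s0_grp R (subgrp G2) = 0).
Proof.
have [s1 ns1 n1] := string_numbers_summand R hG.
have [s2 ns2 n2] := string_numbers_summand R (internal_direct_sumC hG).
by split; [|split] => h; split; auto.
Qed.
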